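(* For every integer $w\ge 1$ there is an integer $n_0$ such that if $n\ge n_0$, then $\operatorname{ldim}(P(n,w))=\operatorname{bdim}(P(n,w))=w+1$.
   Context: For positive integers $n,w$, $P(n,w)$ is the poset with $nw+n^w$ points defined as follows. There are $w$ pairwise disjoint chains $C_1,\dots,C_w$, with $C_i$ consisting of $x_{i,1}<x_{i,2}<\dots<x_{i,n}$, and points of different chains incomparable. For each sequence $\sigma=(j_1,\dots,j_w)\in\{1,\dots,n\}^w$ there is a maximal element $a_\sigma$ which covers exactly the points $x_{i,j_i}$, $i=1,\dots,w$ (so $x_{i,k}<a_\sigma$ iff $k\le j_i$); the $a_\sigma$ are pairwise incomparable. (Note $w$ is the width of $P(n,w)$ minus its maximal elements.) Local dimension: a partial linear extension (ple) of $P$ is a linear extension of a subposet; for a family $\mathcal{L}$ of ple's, $\mu(u,\mathcal{L})$ is the number of members containing $u$ and $\mu(\mathcal{L})=\max_u\mu(u,\mathcal{L})$; $\mathcal{L}$ (non-empty) is a local realizer if whenever $x\le y$ in $P$ some $L\in\mathcal{L}$ has $x\le y$ in $L$, and whenever $x\parallel y$ in $P$ some $L\in\mathcal{L}$ has $x>y$ in $L$; $\operatorname{ldim}(P)=\min\mu(\mathcal{L})$ over local realizers. Boolean dimension: for a non-empty family $\mathcal{B}=\{L_1,\dots,L_d\}$ of linear orders on the ground set (not necessarily linear extensions) and $\tau:\{0,1\}^d\to\{0,1\}$, let $q(x,y,\mathcal{B})$ have $i$-th bit $1$ iff $x<y$ in $L_i$; $(\mathcal{B},\tau)$ is a Boolean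 realizer if for all distinct $x,y$, $x<y$ in $P$ iff $\tau(q(x,y,\mathcal{B}))=1$; $\operatorname{bdim}(P)$ is the least such $d$. *)

(* Defs.v *)
From HB Require Import structures.
From mathcomp Require Import all_boot all_order.

Set Implicit Arguments.
Unset Strict Implicit.
Unset Printing Implicit Defensive.

Import Order.TTheory.

Definition is_least (A : nat -> Prop) (k : nat) : Prop :=
  A k /\ forall m, A m -> k <= m.

Definition linear_order_on (T : finType) (A : {set T}) (r : rel T) : Prop :=
  [/\ {in A, reflexive r}, {in A &, antisymmetric r},
      {in A & &, transitive r} & {in A &, total r}].

Section LocalDimension.
Context {disp : Order.disp_t} (T : finPOrderType disp).

(* The values of [ple_le] outside [ple_dom] are irrelevant. *)
Record ple := Ple {
  ple_dom : {set T};
  ple_le : rel T;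
  ple_linear : linear_order_on ple_dom ple_le;
  ple_extends : {in ple_dom &, forall x y, (x <= y)%O -> ple_le x y}
}.

Definition le_in (L : ple) (x y : T) : bool :=
  [&& x \in ple_dom L, y \in ple_dom L & ple_le L x y].

Definition lt_in (L : ple) (x y : T) : bool := (x != y) && le_in L x y.

(* On a finite poset only finite families have finite multiplicity, so families
   are indexed by ['I_m]; an index, not a set, keeps repeated members. *)
Definition mult (m : nat) (F : 'I_m -> ple) (u : T) : nat :=
  #|[set i | u \in ple_dom (F i)]|.

Definition max_mult (m : nat) (F : 'I_m -> ple) : nat :=
  \max_(u : T) mult F u.

Definition local_realizer (m : nat) (F : 'I_m -> ple) : Prop :=
  [/\ 0 < m,
      forall x y : T, (x <= y)%O -> exists i, le_in (F i) x y
    & forall x y : T, (x >< y)%O -> exists i, lt_in (F i) y x].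

Definition is_ldim : nat -> Prop :=
  is_least (fun k => exists (m : nat) (F : 'I_m -> ple),
    local_realizer F /\ max_mult F = k).

End LocalDimension.

Section BooleanDimension.
Context {disp : Order.disp_t} (T : finPOrderType disp).

Definition query (d : nat) (B : 'I_d -> rel T) (x y : T) : {ffun 'I_d -> bool} :=
  [ffun i => (x != y) && B i x y].

Definition Boolean_realizer (d : nat) (B : 'I_d -> rel T)
    (tau : {ffun 'I_d -> bool} -> bool) : Prop :=
  [/\ 0 < d,
      forall i, linear_order_on [set: T] (B i)
    & forall x y : T, x != y -> (x < y)%O = tau (query B x y)].

Definition is_bdim : nat -> Prop :=
  is_least (fun d => exists (B : 'I_d -> rel T)
    (tau : {ffun 'I_d -> bool} -> bool), Boolean_realizer B tau).

End BooleanDimension.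

(* [chain_pt i k] is the [k]-th point of the [i]-th chain and [top_pt s] is the
   maximal element [a_s]; indices start at 0. *)
Inductive Pnw (n w : nat) : Type :=
| chain_pt of 'I_w & 'I_n
| top_pt of {ffun 'I_w -> 'I_n}.

Arguments chain_pt {n w} i k.
Arguments top_pt {n w} s.

Definition Pnw_code (n w : nat) (u : Pnw n w) :
    'I_w * 'I_n + {ffun 'I_w -> 'I_n} :=
  match u with chain_pt i k => inl (i, k) | top_pt s => inr s end.

Definition Pnw_decode (n w : nat)
    (c : 'I_w * 'I_n + {ffun 'I_w -> 'I_n}) : Pnw n w :=
  match c with inl (i, k) => chain_pt i k | inr s => top_pt s end.

Lemma Pnw_codeK (n w : nat) : cancel (@Pnw_code n w) (@Pnw_decode n w).
Proof. by case. Qed.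

Lemma Pnw_decodeK (n w : nat) : cancel (@Pnw_decode n w) (@Pnw_code n w).
Proof. by case=> [[]|]. Qed.

HB.instance Definition _ (n w : nat) :=
  Finite.copy (Pnw n w) (can_type (@Pnw_codeK n w)).

Definition Pnw_le (n w : nat) (u v : Pnw n w) : bool :=
  match u, v with
  | chain_pt i k, chain_pt j l => (i == j) && (k <= l)
  | chain_pt i k, top_pt s => k <= s i
  | top_pt _, chain_pt _ _ => false
  | top_pt s, top_pt t => s == t
  end.

Lemma Pnw_le_refl (n w : nat) : reflexive (@Pnw_le n w).
Proof. by case=> [i k|s] /=; rewrite eqxx ?leqnn. Qed.

Lemma Pnw_le_anti (n w : nat) : antisymmetric (@Pnw_le n w).
Proof.
case=> [i k|s] [j l|t] //=; rewrite ?andbF //; last by case/andP => /eqP->.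
case/andP => /andP[/eqP<- kl] /andP[_ lk].
by congr (chain_pt _ _); apply/val_inj/anti_leq; rewrite kl.
Qed.

Lemma Pnw_le_trans (n w : nat) : transitive (@Pnw_le n w).
Proof.
case=> [j l|t] [i k|s] [h m|r] //=.
- by case/andP => /eqP-> kl /andP[-> lm]; apply: leq_trans kl lm.
- by case/andP => /eqP-> kl; apply: leq_trans kl.
- by move=> kt /eqP<-.
- by move=> /eqP->.
Qed.

Fact Pnw_display : Order.disp_t. Proof. by split; exact: tt. Qed.

HB.instance Definition _ (n w : nat) :=
  Order.Le_isPOrder.Build Pnw_display (Pnw n w)
    (@Pnw_le_refl n w) (@Pnw_le_anti n w) (@Pnw_le_trans n w).

Lemma card_Pnw (n w : nat) : #|{: Pnw n w}| = n * w + n ^ w.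
Proof.
rewrite (bij_eq_card (Bijective (@Pnw_codeK n w) (@Pnw_decodeK n w))).
by rewrite card_sum card_prod card_ffun !card_ord mulnC.
Qed.

Lemma Pnw_covers_top (n w : nat) (u : Pnw n w) (s : {ffun 'I_w -> 'I_n}) :
  ((u < top_pt s)%O /\ forall v, ~~ (u < v < top_pt s)%O)
  <-> exists i, u = chain_pt i (s i).
Proof.
split.
- case: u => [i k|t] [ut H]; last first.
    by move: ut; rewrite lt_def => /andP[/eqP h /eqP e]; rewrite e in h.
  exists i; congr chain_pt; apply/eqP/negPn/negP => ne.
  have kl : k <= s i by move: ut; rewrite lt_def => /andP[_].
  have /negP := H (chain_pt i (s i)); rewrite !lt_def; apply.
  have -> : (chain_pt i k <= chain_pt i (s i))%O.
    by change ((i == i) && (k <= s i)); rewrite eqxx.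
  have -> : (chain_pt i (s i) <= top_pt s)%O by exact: leqnn.
  rewrite !andbT; apply/eqP => e.
  by case: e => e; rewrite e eqxx in ne.
case=> i ->; split.
  by rewrite lt_def; apply/andP; split; [apply/eqP | exact: leqnn].
case=> [j l|t]; apply/negP; rewrite !lt_def => /andP[/andP[h1 h2] /andP[h3 h4]].
- case/andP: h2 => /eqP e lk; subst j; have h : l <= s i by exact: h4.
  by case/eqP: h1; congr chain_pt; apply/val_inj/anti_leq; rewrite h lk.
- by case/eqP: h3; rewrite (eqP (h4 : t == s)).
Qed.

(* Main.v *)
(** Upper bounds: [w + 1] linear extensions suffice, one pushing each chain as
    high as possible above the maximal elements, and one taking care of the pairs
    of maximal elements; they serve both as a local and as a Boolean realizer.

    Lower bounds: by the product Ramsey theorem one finds a grid with two values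
    [k i < l i] in each coordinate on which all choices made below are uniform.
    - Suppose every point lies in at most [w] partial extensions, and let
      [L s i] reverse [x_{i, s i + 1}] and [a_s]. On the grid, [L s i] depends
      only on [s i], and the [L s i] are distinct for distinct [i], so they are
      all the members containing [a_s]. A member with [a_l < a_k] must then be
      [L k i = L l i] for some [i], but there [a_k < x_{i, k i + 1} <= a_l].
    - Suppose [w] linear orders form a Boolean realizer. By Ramsey's theorem for
      pairs each chain may be assumed monotone in every order. Some order [t i] puts
      [a_s] between [x_{i, s i}] and [x_{i, s i + 1}], as the two queries differ.
      Hence on the grid [t i] sorts the [a_s] by their [i]-th coordinate, so [t]
      is injective and thus bijective, every query is of the form
      [q(a_u, a_v)], and [tau] vanishes. *)
Require Import Defs.
From mathcomp Require Import all_boot all_order.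
From mathcomp Require Import zify.

Set Implicit Arguments.
Unset Strict Implicit.
Unset Printing Implicit Defensive.

Import Order.TTheory.

(** * Pigeonhole and Ramsey lemmas, for pairs and for products *)

Lemma pigeonhole_seq (T : Type) (C : finType) (h : T -> C) (m : nat) (s : seq T) :
  #|C| * m < size s -> exists c, m < count (fun x => h x == c) s.
Proof.
have -> : size s = \sum_c count (fun x => h x == c) s.
  elim: s => [|x s IHs] /=; first by rewrite big1.
  rewrite big_split /= -IHs (bigD1 (h x)) //= eqxx big1 ?addn0 // => c ne_c.
  by rewrite eq_sym (negPf ne_c).
move=> lt_m; apply/existsP; apply: contraLR lt_m.
rewrite negb_exists -leqNgt => /forallP le_m.
rewrite -sum_nat_const; apply: leq_sum => c _.
by rewrite leqNgt.
Qed.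

(** Keep the head [x], pass to a large colour class of [f x] on the tail, and recurse. The colour of
    a pair in [s'] then depends only on its earlier member, and [z] serves to name that colour as
    [f x z]. *)
Lemma end_homogeneous (C : finType) (m : nat) :
  exists N, forall (T : eqType) (f : T -> T -> C) (s : seq T), N < size s ->
    exists z s', [/\ z \in s, subseq s' s, size s' = m
                   & pairwise (fun x y => f x y == f x z) s'].
Proof.
elim: m => [|m [N IHm]].
  exists 0 => T f [|x s] // _.
  by exists x, [::]; rewrite mem_head sub0seq.
exists (#|C| * N).+1 => T f [|x s] //=; rewrite ltnS.
case/(pigeonhole_seq (f x)) => c; rewrite -size_filter.
case/(IHm T f) => z [s' [zs s's <- hom]]; exists z, (x :: s').
move: zs; rewrite mem_filter => /andP[/eqP fxz zs].
split; rewrite //= ?inE ?zs ?orbT ?eqxx ?hom ?andbT //.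
  exact: subseq_trans s's (filter_subseq _ _).
by apply/allP => y /(mem_subseq s's); rewrite mem_filter fxz => /andP[].
Qed.

Lemma ramsey_pairs (C : finType) (m : nat) :
  exists N, forall f : nat -> nat -> C, exists (g : nat -> nat) (c : C),
    (forall i, i < m -> g i < N) /\
    (forall i j, i < j < m -> g i < g j /\ f (g i) (g j) = c).
Proof.
have [N hN] := end_homogeneous C (#|C| * m).+1.
exists N.+1 => f; have := hN _ f (iota 0 N.+1); rewrite size_iota ltnSn => /(_ isT).
case=> z [s [_ s_iota size_s hom]].
(* A second pigeonhole, on the colour attached to each point, makes all pairs agree. *)
have [|c lt_m] := @pigeonhole_seq _ C (fun x => f x z) m s; first by rewrite size_s.
set s' := filter (fun x => f x z == c) s.
have s's : subseq s' s by exact: filter_subseq.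
have lt_s' : m < size s' by rewrite size_filter.
exists (nth 0 s'), c; split=> [i lt_im|i j /andP[lt_ij lt_jm]].
  have /(mem_subseq s's)/(mem_subseq s_iota) : nth 0 s' i \in s'.
    by rewrite mem_nth // (ltn_trans lt_im).
  by rewrite mem_iota.
have lt_js : j < size s' by apply: ltn_trans lt_jm _.
have lt_is : i < size s' by apply: ltn_trans lt_ij _.
split.
  have : pairwise ltn s'.
    apply: subseq_pairwise s's _; apply: subseq_pairwise s_iota _.
    by rewrite -(sorted_pairwise ltn_trans) iota_ltn_sorted.
  by move/(pairwiseP 0)/(_ i j lt_is lt_js lt_ij).
have /(pairwiseP 0)/(_ i j lt_is lt_js lt_ij)/eqP -> := subseq_pairwise s's hom.
by have := mem_nth 0 lt_is; rewrite mem_filter => /andP[/eqP].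
Qed.

(** By induction on [w], colouring the remaining coordinates by functions of the first one; hence
    [C] must vary. A function on [#|C| + 1] values repeats a colour, which gives the two values of
    the first coordinate. *)
Lemma product_ramsey_seq (w : nat) : forall C : finType,
  exists N, forall f : seq nat -> C, exists (k l : nat -> nat) (c : C),
    (forall i, i < w -> k i < l i <= N) /\
    (forall e : pred nat, f (mkseq (fun i => if e i then l i else k i) w) = c).
Proof.
elim: w => [|w IHw] C; first by exists 0 => f; exists id, id, (f [::]).
have [N hN] := IHw {ffun 'I_#|C|.+1 -> C}.
exists (maxn N #|C|) => f.
have [k [l [c [kl fc]]]] := hN (fun s => [ffun p => f (nat_of_ord p :: s)]).
have [p [q [lt_pq cpq]]] : exists p q : 'I_#|C|.+1, p < q /\ c p = c q.
  have /injectivePn[p [q ne_pq cpq]] : ~~ injectiveb c.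
    by apply/injectiveP => /leq_card; rewrite card_ord ltnn.
  have [lt|gt|/val_inj/eqP] := ltngtP p q; [by exists p, q | by exists q, p |].
  by rewrite (negPf ne_pq).
exists (fun i => if i is i'.+1 then k i' else p : nat).
exists (fun i => if i is i'.+1 then l i' else q : nat), (c p).
split=> [[_|i /kl/andP[-> /= le_lN]]|e].
- by rewrite lt_pq leq_max -[X in _ || X]ltnS ltn_ord orbT.
- by rewrite leq_max le_lN.
rewrite /mkseq /= (iotaDl 1 0) -map_comp.
have := fc (fun i => e i.+1); case: (e 0) => [/ffunP/(_ q)|/ffunP/(_ p)];
  by rewrite ffunE ?cpq.
Qed.

Definition box (I T : finType) (k l : {ffun I -> T}) (e : pred I) : {ffun I -> T} :=
  [ffun i => if e i then l i else k i].

Lemma product_ramsey (w : nat) (C : finType) :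
  exists N, forall f : {ffun 'I_w -> 'I_N.+1} -> C,
  exists (k l : {ffun 'I_w -> 'I_N.+1}) (c : C),
    (forall i, k i < l i) /\ (forall e, f (box k l e) = c).
Proof.
have [N hN] := product_ramsey_seq w C; exists N => f.
have [k [l [c [kl fc]]]] := hN (fun s => f [ffun i : 'I_w => inord (nth 0 s i)]).
exists [ffun i : 'I_w => inord (k i)], [ffun i : 'I_w => inord (l i)], c.
split=> [i|e].
  rewrite !ffunE; have /andP[lt_kl le_lN] := kl i (ltn_ord i).
  by rewrite !inordK // ltnS // (leq_trans (ltnW lt_kl)).
rewrite -(fc (fun i => if insub i is Some i' then e i' else false)).
congr f; apply/ffunP => i; rewrite !ffunE nth_mkseq // valK.
by case: (e i).
Qed.

(** * The [w + 1] linear extensions of the upper bound *)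

Section LinearExtensions.
Variables n w : nat.
Local Notation T := (Pnw n w.+1).
Local Notation M := #|{: {ffun 'I_w.+1 -> 'I_n}}|.

(** Sorts by the [i]-th coordinate, ties broken by [enum_rank]. The successor avoids the multiples
    of [M.+1], which are left for the points of the [i]-th chain. *)
Definition top_height (i : 'I_w.+1) (s : {ffun 'I_w.+1 -> 'I_n}) : nat :=
  s i * M.+1 + (enum_rank s).+1.

(* [height (Some i)] puts every other chain at the bottom and pushes the points
   of the [i]-th chain as high as possible; [height None] puts all chains at the
   bottom and lists the maximal elements in the order opposite to the one of
   [height (Some ord0)]. *)
Definition height (o : option 'I_w.+1) (u : T) : nat :=
  match o, u with
  | Some i, chain_pt j k => if j == i then w.+1 * n + k * M.+1 else j * n + k
  | Some i, top_pt s => w.+1 * n + top_height i s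
  | None, chain_pt j k => j * n + k
  | None, top_pt s => w.+1 * n + (n * M.+1 - top_height ord0 s)
  end.

Lemma top_height_lt i (s : {ffun 'I_w.+1 -> 'I_n}) (k : nat) :
  s i < k -> top_height i s < k * M.+1.
Proof.
move=> lt_sk; apply: (@leq_trans ((s i).+1 * M.+1)); last by rewrite leq_mul2r lt_sk orbT.
by rewrite /top_height mulSn addnC ltn_add2r ltnS ltn_ord.
Qed.

Lemma top_height_inj i : injective (top_height i).
Proof.
move=> s t eq_st; apply/enum_rank_inj/val_inj.
have /(congr1 (modn^~ M.+1)) := eq_st.
rewrite /top_height !modnMDl !modn_small ?ltnS ?ltn_ord //.
by case.
Qed.

Lemma chain_height_lt (j : 'I_w.+1) (k : 'I_n) : j * n + k < w.+1 * n.
Proof.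
apply: (@leq_trans (j.+1 * n)); last by rewrite leq_mul2r ltn_ord orbT.
by rewrite mulSn addnC ltn_add2r.
Qed.

Lemma chain_height_inj (i j : 'I_w.+1) (k l : 'I_n) :
  i * n + k = j * n + l -> i = j /\ k = l.
Proof.
move=> e; have n0 : 0 < n by apply: leq_ltn_trans (ltn_ord k).
split; apply: val_inj.
  by have /(congr1 (divn^~ n)) := e; rewrite !divnMDl // !divn_small ?addn0.
by have /(congr1 (modn^~ n)) := e; rewrite !modnMDl !modn_small.
Qed.

Lemma height_inj o : injective (height o).
Proof.
case: o => [i|] [j k|s] [j' k'|t] /=.
- case: eqP => [->|_]; case: eqP => [->|_].
  + move/eqP; rewrite eqn_add2l eqn_mul2r => /eqP e.
    by congr chain_pt; apply: val_inj.
  + by have := chain_height_lt j' k'; lia.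
  + by have := chain_height_lt j k; lia.
  + by case/chain_height_inj => -> ->.
- case: eqP => [_|_]; last by have := chain_height_lt j k; lia.
  move/eqP; rewrite eqn_add2l => /eqP /(congr1 (modn^~ M.+1)).
  by rewrite modnMl modnMDl modn_small // ltnS ltn_ord.
- case: eqP => [_|_]; last by have := chain_height_lt j' k'; lia.
  move/eqP; rewrite eqn_add2l => /eqP /(congr1 (modn^~ M.+1)).
  by rewrite modnMl modnMDl modn_small // ltnS ltn_ord.
- by move=> e; congr top_pt; apply: (@top_height_inj i); lia.
- by case/chain_height_inj => -> ->.
- by have := chain_height_lt j k; lia.
- by have := chain_height_lt j' k'; lia.
- have := @top_height_lt ord0 s n (ltn_ord _).
  have := @top_height_lt ord0 t n (ltn_ord _).
  by move=> lt_t lt_s e; congr top_pt; apply: (@top_height_inj ord0); lia.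
Qed.

Lemma le_height (x y : T) :
  (x <= y)%O <-> forall o, height o x <= height o y.
Proof.
split.
- case: x y => [i k|s] [j l|t] => [/andP[/eqP <- kl]|kt|//|/eqP -> //] [h|] /=.
  + by case: eqP => _; rewrite leq_add2l ?leq_mul2r kl ?orbT.
  + by rewrite leq_add2l.
  + case: eqP => [<-|_]; last by have := chain_height_lt i k; lia.
    rewrite leq_add2l /top_height; apply: leq_trans (leq_addr _ _).
    by rewrite leq_mul2r (_ : k <= t i) ?orbT.
  + by have := chain_height_lt i k; lia.
- move=> le_xy; apply: contraT => nle.
  suff [o] : exists o, height o y < height o x by rewrite ltnNge le_xy.
  case: x y nle {le_xy} => [i k|s] [j l|t] nle.
  + have [e|ne] := eqVneq j i.
      subst j; exists None; rewrite /= ltn_add2l ltnNge.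
      by apply: contraNN nle => kl; apply/andP.
    exists (Some i); rewrite /= eqxx (negPf ne).
    by have := chain_height_lt j l; lia.
  + exists (Some i); rewrite /= eqxx ltn_add2l top_height_lt //.
    by rewrite ltnNge; exact: nle.
  + by exists None => /=; have := chain_height_lt j l; lia.
  + have := @top_height_lt ord0 s n (ltn_ord _).
    have := @top_height_lt ord0 t n (ltn_ord _).
    have [lt|gt|e] := ltngtP (top_height ord0 t) (top_height ord0 s).
    * by exists (Some ord0); rewrite /= ltn_add2l.
    * by exists None; rewrite /= ltn_add2l; lia.
    * by case/eqP: nle; apply: (@top_height_inj ord0).
Qed.

(** [unlift ord0] identifies the indices with [option 'I_w.+1], [ord0] standing for [None]. *)
Definition height_le (t : 'I_w.+2) : rel T :=
  fun x y => height (unlift ord0 t) x <= height (unlift ord0 t) y.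

Lemma le_height_le (x y : T) : (x <= y)%O <-> forall t, height_le t x y.
Proof.
split=> [/le_height le_xy t|le_xy]; first exact: le_xy.
apply/le_height => -[i|].
  by have := le_xy (lift ord0 i); rewrite /height_le liftK.
by have := le_xy ord0; rewrite /height_le unlift_none.
Qed.

Lemma height_le_linear (A : {set T}) t : linear_order_on A (height_le t).
Proof.
split.
- by move=> x _; apply: leqnn.
- by move=> x y _ _ /anti_leq /height_inj.
- by move=> y x z _ _ _; apply: leq_trans.
- by move=> x y _ _; apply: leq_total.
Qed.

Lemma height_le_extends (A : {set T}) t :
  {in A &, forall x y, (x <= y)%O -> height_le t x y}.
Proof. by move=> x y _ _ /le_height_le. Qed.

Definition height_ple t : ple T :=
  Ple (height_le_linear setT t) (@height_le_extends setT t).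

Lemma height_local_realizer : local_realizer height_ple.
Proof.
split=> // x y.
  by move/le_height_le => le_xy; exists ord0; rewrite /le_in /= !inE le_xy.
move=> inc; have ne_yx : y != x.
  by apply: contraTneq inc => ->; rewrite comparablexx.
have /existsP[t nle] : [exists t, ~~ height_le t x y].
  rewrite -negb_forall; apply: contraNN inc => /forallP/le_height_le.
  by rewrite /Order.comparable => ->.
exists t; rewrite /lt_in /le_in ne_yx /= !inE.
by move: nle; rewrite /height_le -ltnNge => /ltnW.
Qed.

Lemma height_max_mult : 0 < n -> max_mult height_ple = w.+2.
Proof.
move=> n0; have mu u : mult height_ple u = w.+2.
  by rewrite /mult -[RHS]card_ord; apply: eq_card => t; rewrite inE in_setT.
apply/eqP; rewrite eqn_leq; apply/andP; split.
  by apply/bigmax_leqP => u _; rewrite mu.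
(* Positivity of [n] provides a point at which the maximum is attained. *)
by rewrite -[leqLHS](mu (chain_pt ord0 (Ordinal n0))) leq_bigmax.
Qed.

Lemma height_Boolean_realizer :
  Boolean_realizer height_le (fun q => [forall t, q t]).
Proof.
split=> // [t|x y ne_xy]; first exact: height_le_linear.
rewrite lt_neqAle ne_xy /=; apply/idP/forallP.
  by move/le_height_le => le_xy t; rewrite ffunE ne_xy le_xy.
move=> q; apply/le_height_le => t.
by have := q t; rewrite ffunE ne_xy.
Qed.

End LinearExtensions.

(** * Lower bound for the local dimension *)

Lemma ldim_lower_bound (w : nat) :
  exists n0, forall n, n0 <= n -> forall m (F : 'I_m -> ple (Pnw n w.+1)),
    local_realizer F -> w.+1 < max_mult F.
Proof.
have [N hN] := product_ramsey w.+1 {ffun 'I_w.+1 -> 'I_w.+1 * 'I_w.+1}.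
(* Grid coordinates are at most [N], and their successors must still index chain points. *)
exists N.+2 => -[//|n]; rewrite ltnS => lt_Nn m F [_ _ revF].
rewrite ltnNge; apply/negP => le_mult.
have {}le_mult u : #|[set i | u \in ple_dom (F i)]| <= w.+1.
  exact: leq_trans (leq_bigmax (F := mult F) u) le_mult.
pose pos L u : 'I_w.+1 := inord (index L (enum [set i | u \in ple_dom (F i)])).
have pos_inj u L L' : u \in ple_dom (F L) -> u \in ple_dom (F L') ->
    pos L u = pos L' u -> L = L'.
  move=> uL uL' /(congr1 (@nat_of_ord _)); rewrite /pos.
  have iL : L \in enum [set i | u \in ple_dom (F i)] by rewrite mem_enum inE.
  have iL' : L' \in enum [set i | u \in ple_dom (F i)] by rewrite mem_enum inE.
  have lt_index L0 : L0 \in enum [set i | u \in ple_dom (F i)] ->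
      index L0 (enum [set i | u \in ple_dom (F i)]) < w.+1.
    by rewrite -index_mem -cardE => /leq_trans-> //; rewrite le_mult.
  rewrite !inordK ?lt_index // => eq_index.
  by rewrite -(nth_index L iL) eq_index nth_index.
pose x (i : 'I_w.+1) (p : nat) : Pnw n.+1 w.+1 := chain_pt i (inord p).
pose a (s : {ffun 'I_w.+1 -> 'I_N.+1}) : Pnw n.+1 w.+1 :=
  top_pt [ffun i => inord (s i)].
have x_le_a i (p : nat) s : p <= N.+1 -> (x i p <= a s)%O = (p <= s i).
  move=> le_pN; rewrite -[LHS]/(_ <= _)%N ffunE !inordK //.
    by have := ltn_ord (s i); lia.
  by lia.
have a_neq (s s' : {ffun 'I_w.+1 -> 'I_N.+1}) i : s i < s' i -> a s != a s'.
  move=> lt_ss'; apply/eqP => -[] /ffunP/(_ i).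
  rewrite !ffunE => /(congr1 (@nat_of_ord _)).
  by rewrite !inordK; have := ltn_ord (s' i); lia.
have /fin_all_exists[L HL] s : exists Ls : 'I_w.+1 -> 'I_m,
    forall i, lt_in (F (Ls i)) (a s) (x i (s i).+1).
  apply: (fin_all_exists (P := fun i L => lt_in (F L) (a s) (x i (s i).+1))) => i.
  by apply: revF; rewrite /Order.comparable x_le_a ?ltnn // ltn_ord.
(* The position of a member among those containing a fixed point takes at most
   [w + 1] values, which makes the coloring finite although [m] is unbounded. *)
have [k [l [c [kl fc]]]] := hN (fun s =>
  [ffun i => (pos (L s i) (x i (s i).+1), pos (L s i) (a s))]).
pose b := box k l.
have bE e i : b e i = if e i then l i else k i by rewrite ffunE.
have cE e i : c i = (pos (L (b e) i) (x i (b e i).+1), pos (L (b e) i) (a (b e))).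
  by rewrite -(fc e) ffunE.
have dom_x e i : x i (b e i).+1 \in ple_dom (F (L (b e) i)).
  by case/and4P: (HL (b e) i).
have dom_a e i : a (b e) \in ple_dom (F (L (b e) i)).
  by case/and4P: (HL (b e) i).
(* Both members contain the same chain point, at the same position by uniformity. *)
have L_coord e e' i : e i = e' i -> L (b e) i = L (b e') i.
  move=> ee'; have bb' : b e i = b e' i by rewrite !bE ee'.
  apply: (pos_inj (x i (b e i).+1)); rewrite ?dom_x //.
    by rewrite bb' dom_x.
  by have := cE e i; rewrite (cE e' i) => -[<- _]; rewrite bb'.
have a_lt (e e' : pred 'I_w.+1) i :
    ~~ e i -> e' i -> a (b e') \in ple_dom (F (L (b e) i)) ->
    a (b e) != a (b e') /\ ple_le (F (L (b e) i)) (a (b e)) (a (b e')).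
  move=> ei e'i dom_e'; split.
    by apply: (a_neq _ _ i); rewrite !bE (negPf ei) e'i kl.
  have /and4P[_ _ _ le_ax] := HL (b e) i.
  have [_ _ trF _] := ple_linear (F (L (b e) i)).
  apply: trF le_ax _; rewrite ?dom_a ?dom_x //.
  apply: ple_extends; rewrite ?dom_x // x_le_a ?ltn_ord //.
  by rewrite !bE (negPf ei) e'i.
have anti_a e e' i : a (b e) != a (b e') ->
    ple_le (F i) (a (b e)) (a (b e')) -> ple_le (F i) (a (b e')) (a (b e)) ->
    a (b e) \in ple_dom (F i) -> a (b e') \in ple_dom (F i) -> False.
  move=> /eqP ne le1 le2 d1 d2; have [_ antiF _ _] := ple_linear (F i).
  by apply/ne/antiF; rewrite ?le1.
(* Positions around [a (b e)] do not depend on [e], so a coincidence at one corner occurs at all. *)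
have L_eq e e' i j : L (b e) i = L (b e) j -> L (b e') i = L (b e') j.
  move=> Lij; apply: (pos_inj (a (b e'))); rewrite ?dom_a //.
  have pos_a e0 i0 : pos (L (b e0) i0) (a (b e0)) = (c i0).2 by rewrite (cE e0).
  by rewrite !pos_a -!(pos_a e) Lij.
(* Otherwise a single member would order the corners [pred1 i] and [pred1 j] both ways. *)
have L_inj e : injective (L (b e)).
  move=> i j Lij; apply/eqP; apply: contraT => ne_ij.
  have e1 : L (b (pred1 j)) i = L (b (pred1 i)) j.
    rewrite (L_coord (pred1 j) pred0 i) ?(L_coord (pred1 i) pred0 j) /=.
    + exact: L_eq Lij.
    + by rewrite eq_sym (negPf ne_ij).
    + by rewrite (negPf ne_ij).
  have [|||ne le1] := a_lt (pred1 j) (pred1 i) i; rewrite /= ?eqxx //.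
    by rewrite e1 dom_a.
  have [|||_ le2] := a_lt (pred1 i) (pred1 j) j; rewrite /= ?eqxx //.
    + by rewrite eq_sym.
    + by rewrite -e1 dom_a.
  rewrite -e1 in le2; case: (anti_a _ _ _ ne le1 le2); rewrite ?dom_a //.
  by rewrite e1 dom_a.
have L_onto e X : a (b e) \in ple_dom (F X) -> exists i, X = L (b e) i.
  move=> aX; have : X \in [set L (b e) i | i in 'I_w.+1].
    have -> : [set L (b e) i | i in 'I_w.+1] = [set X | a (b e) \in ple_dom (F X)].
      apply/eqP; rewrite eqEcard card_imset ?card_ord ?le_mult ?andbT //.
      by apply/subsetP => _ /imsetP[i _ ->]; rewrite inE dom_a.
    by rewrite inE.
  by case/imsetP => i _ ->; exists i.
have [X] : exists X, lt_in (F X) (a (b predT)) (a (b pred0)).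
  apply: revF; have ne : a (b pred0) != a (b predT).
    by apply: (a_neq _ _ ord0); rewrite !bE kl.
  have le_a s s' : (a s <= a s')%O -> a s = a s' by move=> /eqP st; congr top_pt.
  by apply/negP => /orP[] /le_a e; rewrite e eqxx in ne.
case/and4P => ne dT d0 le1; have [i Xi] := L_onto _ _ d0; have [j Xj] := L_onto _ _ dT.
(* If [i] and [j] differed, the corner [pred1 j] would see [X] at both coordinates, against
   [L_inj]. *)
have eq_ij : i = j.
  have [//|ne_ij] := eqVneq i j; apply: (L_inj (pred1 j)).
  rewrite (L_coord (pred1 j) pred0 i) ?(L_coord (pred1 j) predT j) /= ?eqxx //.
    by rewrite -Xi -Xj.
  by rewrite (negPf ne_ij).
have := a_lt pred0 predT i isT isT; rewrite -Xi => /(_ dT)[_ le2].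
exact: (anti_a _ _ _ ne le1 le2 dT d0).
Qed.

(** * Lower bound for the Boolean dimension *)

(** Surplus indices repeat the first order, the default value of [inord], and the new [tau] ignores
    their bits. This allows assuming exactly [w + 1] orders below. *)
Lemma Boolean_realizer_widen (disp : Order.disp_t) (T : finPOrderType disp)
    (d d' : nat) (B : 'I_d -> rel T) tau :
  d <= d' -> Boolean_realizer B tau ->
  exists (B' : 'I_d' -> rel T) tau', Boolean_realizer B' tau'.
Proof.
case: d B tau => [|d] B tau le_dd' [//] _ linB tauP.
exists (fun i => B (inord i)), (fun q => tau [ffun j => q (widen_ord le_dd' j)]).
split=> [||x y ne_xy]; [exact: leq_trans le_dd' | by move=> i |].
rewrite tauP //; congr tau; apply/ffunP => j.
by rewrite !ffunE /= inord_val.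
Qed.

Lemma bdim_lower_bound (w : nat) :
  exists n0, forall n, n0 <= n -> forall d (B : 'I_d -> rel (Pnw n w.+1)) tau,
    Boolean_realizer B tau -> w.+1 < d.
Proof.
have [N hN] := product_ramsey w.+1 {ffun 'I_w.+1 -> 'I_w.+1 * bool}.
have [N1 hN1] := ramsey_pairs {ffun 'I_w.+1 -> bool} N.+2.
exists N1.+1 => -[//|n]; rewrite ltnS => le_N1n d B0 tau0 real0.
rewrite ltnNge; apply/negP => /Boolean_realizer_widen/(_ real0).
case=> B [tau [_ linB tauP]] {d B0 tau0 real0}.
have BN t u v : u != v -> B t v u = ~~ B t u v.
  move=> /eqP ne; have [_ antiB _ totB] := linB t.
  have := totB u v (in_setT _) (in_setT _).
  case uv: (B t u v); case vu: (B t v u) => // _.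
  by case: ne; apply: antiB; rewrite ?in_setT ?uv.
have Btrans t v u y : B t u v -> B t v y -> B t u y.
  by have [_ _ trB _] := linB t; apply: trB; rewrite in_setT.
have Brefl t u : B t u u by have [reflB _ _ _] := linB t; apply: reflB; rewrite in_setT.
(* The colour of a pair records all orders at once: [c i t] tells whether the thinned chain [i]
   ascends in the order [t]. *)
have /fin_all_exists[g /fin_all_exists[c hg]] (i : 'I_w.+1) := hN1 (fun p q =>
  [ffun t => B t (chain_pt i (inord p)) (chain_pt i (inord q))]).
pose x (i : 'I_w.+1) (p : nat) : Pnw n.+1 w.+1 := chain_pt i (inord (g i p)).
pose a (s : {ffun 'I_w.+1 -> 'I_N.+1}) : Pnw n.+1 w.+1 :=
  top_pt [ffun i => inord (g i (s i))].
have g_lt i p q : p < N.+2 -> q < N.+2 -> (g i p < g i q) = (p < q).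
  have [_ mono] := hg i; move=> ltp ltq.
  have [lt_pq|lt_qp|->] := ltngtP p q; last by rewrite ltnn.
    by case: (mono p q) => //; rewrite lt_pq.
  case: (mono q p) => [|lt_g _]; first by rewrite lt_qp.
  by rewrite ltnNge ltnW.
have g_K i p : p < N.+2 -> (inord (g i p) : 'I_n.+1) = g i p :> nat.
  by have [lt_gN _] := hg i; move=> /lt_gN lt_g; rewrite inordK //; lia.
have s_lt (s : {ffun 'I_w.+1 -> 'I_N.+1}) i : s i < N.+2 by apply: ltnW; rewrite ltnS.
have x_lt_a i p s : p < N.+2 -> (x i p < a s)%O = (p <= s i).
  move=> ltp; rewrite lt_neqAle -[(_ <= _)%O]/(_ <= _)%N ffunE !g_K //.
  by rewrite leqNgt g_lt // -leqNgt; case: eqP.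
have Bx t i p q : p < q < N.+2 -> B t (x i p) (x i q) = c i t.
  by move=> pq; have [_ /(_ p q pq)[_ <-]] := hg i; rewrite ffunE.
have x_neq i p q : p < q < N.+2 -> x i p != x i q.
  move=> /andP[pq ltq]; have ltp := ltn_trans pq ltq.
  apply/eqP => -[] /(congr1 (@nat_of_ord _)); rewrite !g_K // => e.
  by have := g_lt i p q ltp ltq; rewrite e ltnn pq.
have x_neq_a i p s : x i p != a s by apply/eqP.
have a_neq (s s' : {ffun 'I_w.+1 -> 'I_N.+1}) i : s i < s' i -> a s != a s'.
  move=> lt_ss'; apply/eqP => -[] /ffunP/(_ i).
  rewrite !ffunE => /(congr1 (@nat_of_ord _)); rewrite !g_K // => e.
  by have := g_lt i _ _ (s_lt s i) (s_lt s' i); rewrite e ltnn lt_ss'.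
have /fin_all_exists[sep Hsep] (s : {ffun 'I_w.+1 -> 'I_N.+1}) :
    exists seps : 'I_w.+1 -> 'I_w.+1 * bool, forall i,
    B (seps i).1 (x i (s i)) (a s) = (seps i).2 /\
    B (seps i).1 (x i (s i).+1) (a s) = ~~ (seps i).2.
  apply: (fin_all_exists (P := fun i se => B se.1 (x i (s i)) (a s) = se.2 /\
    B se.1 (x i (s i).+1) (a s) = ~~ se.2)) => i.
  have := tauP (x i (s i).+1) (a s) (x_neq_a _ _ _).
  rewrite x_lt_a ?ltnn; last by rewrite ltnS ltn_ord.
  have := tauP (x i (s i)) (a s) (x_neq_a _ _ _).
  rewrite x_lt_a ?leqnn // => tau1 tau0.
  have /existsP[t ne_t] :
      [exists t, query B (x i (s i)) (a s) t != query B (x i (s i).+1) (a s) t].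
    apply: contraT; rewrite negb_exists => /forallP eq_q.
    suff eqq : query B (x i (s i)) (a s) = query B (x i (s i).+1) (a s).
      by move: tau1; rewrite eqq -tau0.
    by apply/ffunP => t; apply/eqP; rewrite -[_ == _]negbK.
  exists (t, B t (x i (s i)) (a s)); split=> //=.
  by move: ne_t; rewrite !ffunE !x_neq_a /=; case: (B _ _ _); case: (B _ _ _).
have [k [l [col [kl fc]]]] := hN (fun s => [ffun i => sep s i]).
pose b := box k l.
pose t i := (col i).1; pose up i := (col i).2.
have bE e i : b e i = if e i then l i else k i by rewrite ffunE.
have {}Hsep e i : B (t i) (x i (b e i)) (a (b e)) = up i /\
    B (t i) (x i (b e i).+1) (a (b e)) = ~~ up i.
  have := Hsep (b e) i.
  by have /ffunP/(_ i) := fc e; rewrite ffunE => ->.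
(* In the order [t i], the point [a (b pred0)] separates two successive points of chain [i], which
   fixes the direction of the chain. *)
have c_up i : c i (t i) = up i.
  have [] := Hsep pred0 i; rewrite bE /= => B1 B2.
  have lt_k : k i < (k i).+1 < N.+2 by rewrite ltnSn ltnS ltn_ord.
  rewrite -(Bx (t i) i _ _ lt_k); case upE: (up i) B1 B2 => B1 B2.
    by apply: Btrans B1 _; rewrite BN ?x_neq_a // B2.
  rewrite -[LHS]negbK -BN ?x_neq //; apply/negbTE; rewrite negbK.
  by apply: Btrans B2 _; rewrite BN ?x_neq_a // B1.
have Ba (e e' : pred 'I_w.+1) i : ~~ e i -> e' i ->
    B (t i) (a (b e)) (a (b e')) = up i /\ B (t i) (a (b e')) (a (b e)) = ~~ up i.
  move=> ei e'i; have ne : a (b e) != a (b e').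
    by apply: (a_neq _ _ i); rewrite !bE (negPf ei) e'i.
  have [_] := Hsep e i; have [] := Hsep e' i; rewrite !bE (negPf ei) e'i => B1 _ B2.
  suff Bup : B (t i) (a (b e)) (a (b e')) = up i by split; rewrite // BN // Bup.
  (* The point at [(k i).+1] links the two maximal elements; it may coincide with the one at
     [l i]. *)
  have := kl i; rewrite leq_eqVlt => kl_or.
  have Bx_up : if up i then B (t i) (x i (k i).+1) (x i (l i))
               else B (t i) (x i (l i)) (x i (k i).+1).
    case/orP: kl_or => [/eqP ->|lt_kl]; first by rewrite !Brefl if_same.
    have lt_kl' : (k i).+1 < l i < N.+2 by rewrite lt_kl s_lt.
    by rewrite [B _ (x i (l i)) _]BN ?x_neq // Bx // c_up; case: (up i).
  case upE: (up i) Bx_up B1 B2 => /= Bx_up B1 B2.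
    apply: Btrans (Btrans _ _ _ _ _ Bx_up) B1.
    by rewrite BN ?x_neq_a // B2.
  rewrite -[LHS]negbK -BN //; apply/negbTE; rewrite negbK.
  apply: Btrans (Btrans _ _ _ _ _ Bx_up) B2.
  by rewrite BN ?x_neq_a // B1.
(* Two coordinates that are sorted by the same order would have to be sorted both
   in the same direction and in opposite directions. *)
have t_inj : injective t.
  move=> i j tij; apply/eqP; apply: contraT => ne_ij.
  have [||Bi _] := Ba (pred1 j) (pred1 i) i; rewrite /= ?eqxx //.
  have [||_ Bj] := Ba (pred1 i) (pred1 j) j; rewrite /= ?eqxx //.
    by rewrite eq_sym.
  have [//|//|Bi' _] := Ba pred0 predT i.
  have [//|//|Bj' _] := Ba pred0 predT j.
  move: Bi Bj Bi' Bj'; rewrite -tij => -> /= e1 -> e2.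
  by move: e1; rewrite e2; case: (up j).
(* The query of a comparable pair, to be reproduced on two incomparable maximal elements. *)
pose q := query B (x ord0 (b pred0 ord0)) (a (b pred0)).
have tau_q : tau q by rewrite -tauP ?x_neq_a // x_lt_a.
(* [e] is chosen so that the query [(a_u, a_v)] is [q] for [u = b e] and
   [v = b (predC e)]. *)
pose e i := q (t i) != up i.
have : (a (b e) < a (b (predC e)))%O.
  have ne : a (b e) != a (b (predC e)).
    case e0: (e ord0); [rewrite eq_sym|]; apply: (a_neq _ _ ord0);
    by rewrite !bE /= e0 kl.
  rewrite tauP //; congr (is_true (tau _)): tau_q; apply/ffunP => t'.
  (* As [t] is a bijection, the bits at the orders [t i] make up the whole query. *)
  rewrite -(f_invF t_inj t'); set i := invF _ _.
  rewrite [in RHS]ffunE ne /=.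
  case ei: (e i).
    have [||_ ->] := Ba (predC e) e i; rewrite /= ?ei //.
    by move: ei; rewrite /e; case: (q _); case: (up i).
  have [||-> _] := Ba e (predC e) i; rewrite /= ?ei //.
  by move: ei; rewrite /e => /negbT; rewrite negbK => /eqP.
by rewrite lt_neqAle => /andP[/eqP ne /eqP st]; apply: ne; congr top_pt.
Qed.

Theorem theorem3p7 :
  forall w : nat, 1 <= w ->
  exists n0 : nat, forall n : nat, 0 < n -> n0 <= n ->
    is_ldim (Pnw n w) w.+1 /\ is_bdim (Pnw n w) w.+1.
Proof.
case=> // w _.
have [nl ldim_lb] := ldim_lower_bound w; have [nb bdim_lb] := bdim_lower_bound w.
exists (maxn nl nb) => n n_gt0; rewrite geq_max => /andP[le_nl le_nb].
split; split.
- exists w.+2, (@height_ple n w); split; first exact: height_local_realizer.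
  exact: height_max_mult.
- by move=> _ [m [F [realF <-]]]; apply: ldim_lb realF.
- exists (@height_le n w), (fun q => [forall t, q t]).
  exact: height_Boolean_realizer.
- by move=> d [B [tau realB]]; apply: bdim_lb realB.
Qed.
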